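(* Let $\ell_1,\dots,\ell_n:\mathbb{R}^d\to\mathbb{R}$ be twice continuously differentiable, let $T\subseteq[n]$, and suppose $L_T\defeq\sum_{i\notin T}\ell_i$ is convex on $\mathbb{R}^d$. Let $\hat{\theta}$ be a point with $\sum_{i=1}^n\nabla\ell_i(\hat\theta)=0$, and let $\hat\theta_T$ be any point with $\nabla L_T(\hat\theta_T)=0$. Write $g_\theta=\nabla L_T(\theta)$, $H_\theta=\nabla^2L_T(\theta)$, $g=g_{\hat\theta}$, $H=H_{\hat\theta}$, assume $H$ is invertible, and set $\hat\theta_T^{\mathrm{NS}}\defeq\hat\theta-H^{-1}g$. Let $\Sigma$ be a positive-definite $d\times d$ matrix, $r>0$, and $\mathcal{B}\defeq\{\hat\theta_T^{\mathrm{NS}}+e:\ \|e\|_\Sigma\le r\}$. Assume: (i) (strong convexity in $\mathcal B$) $H_\theta$ is invertible and $\|\Sigma^{1/2}H_\theta^{-1}\Sigma^{1/2}\|_{\mathrm{op}}\le C_{\mathrm{op}}$ for all $\theta\in\mathcal{B}$; (ii) (mildly Lipschitz Hessian) $\|(H_\theta-H)H^{-1}g\|_{\Sigma^{-1}}\le C_h$ for all $\theta=t\hat\theta+(1-t)\hat\theta_T^{\mathrm{NS}}$, $t\in[0,1]$; (iii) $C_hC_{\mathrm{op}}<r$. Then $\|\hat\theta_T-\hat\theta_T^{\mathrm{NS}}\|_\Sigma\le C_hC_{\mathrm{op}}$.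
   Context: For a positive-definite matrix $M$, $\|v\|_M\defeq\sqrt{v^\top Mv}$. $\|\cdot\|_{\mathrm{op}}$ is the spectral (operator) norm. $\hat\theta_T^{\mathrm{NS}}$ is the ''single Newton step'' estimate of the model retrained without the samples in $T$. *)

(* Defs.v *)
From HB Require Import structures.
From mathcomp Require Import all_boot all_order all_algebra.
From mathcomp Require Import all_classical all_reals all_analysis.
Set Implicit Arguments. Unset Strict Implicit. Unset Printing Implicit Defensive.
Import Order.TTheory GRing.Theory Num.Theory.
Import numFieldNormedType.Exports.
Local Open Scope classical_set_scope.
Local Open Scope ring_scope.

Section Defs.
Variables (R : realType) (d : nat).

Definition ebasis (j : 'I_d) : 'rV[R]_d := delta_mx 0 j.

Definition partial (j : 'I_d) (f : 'rV[R]_d -> R) : 'rV[R]_d -> R :=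
  fun x => derive f x (ebasis j).

Definition grad (f : 'rV[R]_d -> R) (x : 'rV[R]_d) : 'rV[R]_d :=
  \row_j partial j f x.

Definition hess (f : 'rV[R]_d -> R) (x : 'rV[R]_d) : 'M[R]_d :=
  \matrix_(i, j) partial i (partial j f) x.

Definition C2 (f : 'rV[R]_d -> R) : Prop :=
  (forall x, differentiable f x) /\
  (forall j x, differentiable (partial j f) x) /\
  (forall i j, continuous (partial i (partial j f))).

Definition convex_on_Rd (f : 'rV[R]_d -> R) : Prop :=
  forall (x y : 'rV[R]_d) (t : R), 0 <= t -> t <= 1 ->
    f (t *: x + (1 - t) *: y) <= t * f x + (1 - t) * f y.

Definition posdef (M : 'M[R]_d) : Prop :=
  M^T = M /\ forall v : 'rV[R]_d, v != 0 -> 0 < (v *m M *m v^T) 0 0.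

Definition psd (M : 'M[R]_d) : Prop :=
  M^T = M /\ forall v : 'rV[R]_d, 0 <= (v *m M *m v^T) 0 0.

Definition mnorm (M : 'M[R]_d) (v : 'cV[R]_d) : R :=
  Num.sqrt ((v^T *m M *m v) 0 0).

Definition enorm (v : 'cV[R]_d) : R := Num.sqrt ((v^T *m v) 0 0).

Definition opnorm (A : 'M[R]_d) : R :=
  sup [set enorm (A *m v) / enorm v | v in [set v : 'cV[R]_d | v != 0]].

End Defs.

(* Main.v *)
(** Write [e = theta_T - theta_NS] and [phi s = <grad L_T (theta_NS + s e), e>],
    so that [phi 1 = 0] and, by convexity, [phi] is nondecreasing.  The mean value
    theorem between [theta_NS] and [theta_hat] bounds [phi 0] from below by
    [- C_h |e|_Sigma], while [phi' s >= |e|_Sigma^2 / C_op] as long as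
    [theta_NS + s e] lies in the ball.  At [s = min(1, r / |e|_Sigma)] this gives
    [s |e|_Sigma <= C_h C_op < r], so [s = 1], and this is the claim. *)

Require Import Defs.
From HB Require Import structures.
From mathcomp Require Import all_boot all_order all_algebra.
From mathcomp Require Import all_classical all_reals all_analysis.
From mathcomp Require Import ring lra.
Import Order.TTheory GRing.Theory Num.Theory.
Import numFieldNormedType.Exports.
Local Open Scope classical_set_scope.
Local Open Scope ring_scope.

(** * Calculus along lines: mean values and symmetry of the Hessian *)

Section Analysis.
Set Implicit Arguments. Unset Strict Implicit.
Context {R : realType} {d : nat}.
Implicit Types (f : 'rV[R]_d -> R) (x u v : 'rV[R]_d).

Lemma is_derive_line f x v (s : R) : differentiable f (x + s *: v) ->
  is_derive s 1 (fun t : R => f (x + t *: v)) ('D_v f (x + s *: v)).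
Proof.
move=> /(@diff_derivable _ _ _ f _ v) df.
have E : (fun h : R => h^-1 *: (((fun t : R => f (x + t *: v)) \o shift s) (h *: (1:R)) -
    f (x + s *: v))) =
  (fun h : R => h^-1 *: ((f \o shift (x + s *: v)) (h *: v) - f (x + s *: v))).
  apply/funext => h /=; congr (_ *: (f _ - _)).
  by rewrite [h%:A]mulr1 scalerDl addrCA.
apply: DeriveDef; first by rewrite /derivable E.
by rewrite /derive E.
Qed.

Lemma derive_sum_partial f x v : differentiable f x ->
  'D_v f x = \sum_j v 0 j * partial j f x.
Proof.
move=> df; rewrite deriveE // {1}(row_sum_delta v) linear_sum.
by apply: eq_bigr => j _; rewrite linearZ /partial deriveE.
Qed.

Lemma line_continuous x v : continuous (fun t : R => x + t *: v).
Proof.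
move=> t; apply: (@cvgD _ _ _ _ _ (fun=> x)); first exact: cvg_cst.
by apply: cvgZr_tmp; exact: cvg_id.
Qed.

Lemma line_MVT f x v (a b : R) : (forall y, differentiable f y) -> a < b ->
  exists2 c : R, a < c < b &
    f (x + b *: v) - f (x + a *: v) = (b - a) * 'D_v f (x + c *: v).
Proof.
move=> df ab.
have [|//|c cab ->] := @MVT R (fun t => f (x + t *: v)) (fun t => 'D_v f (x + t *: v)) a b ab.
- by move=> t _; apply: is_derive_line.
- apply: continuous_subspaceT => t.
  apply: (@continuous_comp _ _ _ (fun t : R => x + t *: v) f).
    exact: line_continuous.
  exact: differentiable_continuous.
- by exists c; rewrite 1?mulrC // ; move: cab; rewrite in_itv.
Qed.

(** Two mean value theorems: along [ebasis R i] for the increment of [f] under the shift by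
    [s *: ebasis R j], which yields [c.1], then along [ebasis R j] for [partial i f], which yields
    [c.2]. *)
Lemma second_difference f i j x (s : R) : C2 f -> 0 < s ->
  exists c : R * R, [/\ 0 < c.1 < s, 0 < c.2 < s &
    f (x + s *: ebasis R i + s *: ebasis R j) - f (x + s *: ebasis R i)
      - f (x + s *: ebasis R j) + f x =
    s ^+ 2 * partial j (partial i f) (x + c.1 *: ebasis R i + c.2 *: ebasis R j)].
Proof.
move=> [df [ddf _]] s0.
pose ei := ebasis R i; pose ej := ebasis R j.
have dsh y : differentiable (fun z : 'rV[R]_d => z + s *: ej) y.
  exact: differentiableD.
have dcomp y : differentiable (f \o (fun z : 'rV[R]_d => z + s *: ej)) y.
  by apply: (@differentiable_comp _ _ _ _ _ f y (dsh y)); exact: df.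
pose G := (f \o (fun z => z + s *: ej)) - f.
have dG y : differentiable G y by exact: (differentiableB (dcomp y) (df y)).
have [c1 c1s E1] := @line_MVT G x ei 0 s dG s0.
have DG : 'D_ei G (x + c1 *: ei) =
    partial i f (x + c1 *: ei + s *: ej) - partial i f (x + c1 *: ei).
  rewrite (deriveB (@diff_derivable _ _ _ _ _ ei (dcomp _))
    (@diff_derivable _ _ _ _ _ ei (df _))).
  apply: (congr1 (fun a => a - 'D_ei f (x + c1 *: ei))).
  rewrite /partial /derive -/ei.
  have -> : (fun h : R => h^-1 *: (((f \o (fun z => z + s *: ej)) \o
      shift (x + c1 *: ei)) (h *: ei) - (f \o (fun z => z + s *: ej)) (x + c1 *: ei))) =
    (fun h : R => h^-1 *: ((f \o shift (x + c1 *: ei + s *: ej)) (h *: ei) -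
      f (x + c1 *: ei + s *: ej))).
    by apply/funext => h /=; congr (_ *: (f _ - _)); rewrite -[LHS]addrA.
  by [].
have [c2 c2s E2] := @line_MVT (partial i f) (x + c1 *: ei) ej 0 s (ddf i) s0.
exists (c1, c2); split => //=.
move: E1; rewrite DG; move: E2; rewrite !scale0r !addr0 !subr0 => ->.
rewrite /G !fctE /= -/ei -/ej.
move=> E; rewrite [partial j _ _]/partial -/ej.
rewrite expr2 -mulrA -E; ring.
Qed.

(* Schwarz: the second difference is symmetric in [i, j], and divided by [s ^+ 2] it
   is a value of either mixed partial near [x]. *)
Lemma hess_sym f x : C2 f -> (hess f x)^T = hess f x.
Proof.
move=> C2f; apply/matrixP => i j; rewrite !mxE; apply/eqP/negPn/negP => ne.
case: (C2f) => _ [_ cf].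
set b := partial j (partial i f) x in ne *.
set a := partial i (partial j f) x in ne *.
(* Half the gap, so that no number is within [eps] of both [a] and [b]. *)
pose eps := `|a - b| / 2.
have eps0 : 0 < eps.
  by rewrite divr_gt0 // normr_gt0 subr_eq0 eq_sym.
have /cvgrPdist_lt/(_ _ eps0)/nbhs_normP[d1 /= d10 H1] := cf i j x.
have /cvgrPdist_lt/(_ _ eps0)/nbhs_normP[d2 /= d20 H2] := cf j i x.
pose ei := ebasis R i; pose ej := ebasis R j.
pose dl := Num.min d1 d2.
have dl0 : 0 < dl by rewrite lt_min d10.
(* With [s = dl / k], displacements shorter than [s] along both axes move the point by less than
   [dl]; the summand 1 keeps [k] positive. *)
pose k := 1 + `|ei| + `|ej|.
have k0 : 0 < k.
  by rewrite /k -addrA; apply: ltr_pwDl => //; rewrite addr_ge0.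
pose s := dl / k.
have s0 : 0 < s by rewrite divr_gt0.
have small (c1 c2 : R) : 0 < c1 < s -> 0 < c2 < s ->
   `|x - (x + c1 *: ei + c2 *: ej)| < dl.
  move=> /andP[c10 c1s] /andP[c20 c2s].
  rewrite -addrA opprD addrA subrr sub0r normrN.
  apply: (le_lt_trans (ler_normD _ _)); rewrite !normrZ !gtr0_norm //.
  apply: (@le_lt_trans _ _ (s * (`|ei| + `|ej|))).
    by rewrite mulrDr lerD // ler_wpM2r // ltW.
  have -> : dl = s * k by rewrite /s divfK // gt_eqF.
  by rewrite ltr_pM2l // /k -addrA ltrDr.
have [[c1 c2] /= [A1 A2 A3]] := second_difference i j x C2f s0.
have [[e1 e2] /= [B1 B2 B3]] := second_difference j i x C2f s0.
move: (small _ _ A1 A2) (small _ _ B2 B1); rewrite !lt_min.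
move=> /andP[_ /H2 P2] /andP[+ _].
rewrite -addrA (addrC (_ *: ei)) addrA => /H1 P1.
have E : partial j (partial i f) (x + c1 *: ei + c2 *: ej) =
         partial i (partial j f) (x + e1 *: ej + e2 *: ei).
  apply: (@mulfI _ (s ^+ 2)); first by rewrite expf_neq0 // gt_eqF.
  apply: (etrans (esym A3)); apply: (etrans _ B3).
  rewrite (addrAC x (s *: ebasis R j)).
  by apply: (congr1 (fun a => a + f x)); rewrite [LHS]addrAC.
move: P1 P2; rewrite /= E -/a -/b /eps.
clearbody a b; move: (partial i (partial j f) _) => z P1 P2.
have := ler_distD z a b; rewrite (distrC z b).
by move=> /le_lt_trans/(_ (ltrD P1 P2)); rewrite -splitr ltxx.
Qed.

(** * Second derivatives along lines, and convexity *)

Lemma is_derive_grad_line f x u v (s : R) : C2 f ->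
  is_derive s 1 (fun t : R => (grad f (x + t *: u) *m v^T) 0 0)
    ((u *m hess f (x + s *: u) *m v^T) 0 0).
Proof.
move=> [_ [ddf _]].
have -> : (fun t : R => (grad f (x + t *: u) *m v^T) 0 0) =
    \sum_(j < d) (v 0 j \*: (fun t : R => partial j f (x + t *: u))).
  apply/funext => t; rewrite fct_sumE !mxE; apply: eq_bigr => j _.
  by rewrite !mxE mulrC.
apply: is_derive_eq.
  apply: is_derive_sum => j; apply: is_deriveZ.
  exact: is_derive_line.
rewrite mxE; apply: eq_bigr => j _.
rewrite derive_sum_partial // !mxE [RHS]mulrC; congr (_ * _).
by apply: eq_bigr => i _; rewrite !mxE.
Qed.

(** Pairing with a fixed [v] makes the gradient a scalar function on the line, so its increment is
    an exact Hessian form at one intermediate point. *)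
Lemma grad_line_MVT f x u v (a b : R) : C2 f -> a < b ->
  exists2 c : R, a < c < b &
    (grad f (x + b *: u) *m v^T) 0 0 - (grad f (x + a *: u) *m v^T) 0 0 =
    (b - a) * (u *m hess f (x + c *: u) *m v^T) 0 0.
Proof.
move=> C2f ab.
have dF t := is_derive_grad_line x u v t C2f.
have [|c cab ->] := MVT ab (fun t _ => dF t).
  apply: continuous_subspaceT => t.
  by apply/differentiable_continuous/derivable1_diffP; case: (dF t).
by exists c; rewrite 1?mulrC //; move: cab; rewrite in_itv.
Qed.

Lemma derive_grad f x v : differentiable f x ->
  'D_v f x = (grad f x *m v^T) 0 0.
Proof.
move=> df; rewrite derive_sum_partial // mxE.
by apply: eq_bigr => j _; rewrite !mxE mulrC.
Qed.

Lemma hess_quad_continuous f u v : C2 f ->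
  continuous (fun x => (u *m hess f x *m v^T) 0 0).
Proof.
move=> [_ [_ cf]].
have -> : (fun x => (u *m hess f x *m v^T) 0 0) =
    (fun x => \sum_j \sum_i (u 0 i * v 0 j) * partial i (partial j f) x).
  apply/funext => x; rewrite mxE; apply: eq_bigr => j _.
  rewrite !mxE mulr_suml; apply: eq_bigr => i _; rewrite !mxE; ring.
apply: continuous_big => [|j _]; first exact: add_continuous.
apply: continuous_big => [|i _ x]; first exact: add_continuous.
by apply: (@cvgMl_tmp _ _ (nbhs x)); exact: cf.
Qed.

(* A negative second derivative at [x] along [v] would make the slope over [[0, s]]
   smaller than the slope over [[-s, 0]], against midpoint convexity. *)
Lemma convex_hess_psd f x : C2 f -> convex_on_Rd f -> psd (hess f x).
Proof.
move=> C2f cvxf; split; first exact: hess_sym.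
move=> v; rewrite leNgt; apply/negP => neg.
have cq : {for (0 : R), continuous (fun t : R => (v *m hess f (x + t *: v) *m v^T) 0 0)}.
  apply: (@continuous_comp _ _ _ (fun t : R => x + t *: v)
    (fun y => (v *m hess f y *m v^T) 0 0)).
    exact: line_continuous.
  exact: hess_quad_continuous.
move: cq => /cvgr_lt; rewrite scale0r addr0 => /(_ _ neg)/nbhs_normP[e /= e0 He].
(* Every point of []-s, s[], in particular [c3] below, stays in the window of radius [e] where the
   form is negative. *)
pose s := e / 2.
have s0 : 0 < s by rewrite divr_gt0.
have [c1 c1s E1] := line_MVT x v C2f.1 s0.
have Ns0 : - s < 0 by rewrite oppr_lt0.
have [c2 c2s E2] := line_MVT x v C2f.1 Ns0.
have c21 : c2 < c1 by move: c1s c2s; clear; lra.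
have [c3 c3s E3] := grad_line_MVT x v v C2f c21.
have : (v *m hess f (x + c3 *: v) *m v^T) 0 0 < 0.
  apply: He => /=; rewrite sub0r normrN ltr_norml.
  by move: c1s c2s c3s e0; rewrite /s; clear; lra.
move: E1 E2; rewrite !derive_grad; try exact: C2f.1.
rewrite scale0r addr0 => E1 E2 E4.
have := cvxf (x + s *: v) (x + (- s) *: v) 2^-1.
rewrite invr_ge0 ler0n invf_le1 ?ler1n // => /(_ isT isT).
rewrite (_ : 1 - 2^-1 = 2^-1 :> R); last by field.
have -> : 2^-1 *: (x + s *: v) + 2^-1 *: (x + (- s) *: v) = x.
  rewrite -scalerDr addrACA -scalerDl subrr scale0r addr0 -mulr2n.
  by rewrite -[x *+ 2](scaler_nat 2 x) scalerA mulVf ?pnatr_eq0 // scale1r.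
move: E1 E2 E3 E4.
move: (grad f (x + c1 *: v) *m _) (grad f (x + c2 *: v) *m _) (v *m _ *m _) => p1 p2 q.
move: (f _) (f _) (f _) => a b c E1 E2 E3 E4 M.
have : p1 0 0 < p2 0 0 by rewrite -subr_lt0 E3 nmulr_llt0 // subr_gt0.
rewrite -(ltr_pM2l s0); move: E1 E2 M; clear; lra.
Qed.

(** * Sums of smooth functions *)

Lemma partial_sum n (P : pred 'I_n) (ell : 'I_n -> 'rV[R]_d -> R) j :
  (forall i x, differentiable (ell i) x) ->
  partial j (fun x => \sum_(i < n | P i) ell i x) =
  (fun x => \sum_(i < n | P i) partial j (ell i) x).
Proof.
move=> df; apply/funext => x.
suff : is_derive x (ebasis R j) (fun x => \sum_(i < n | P i) ell i x)
   (\sum_(i < n | P i) partial j (ell i) x) by case=> _ E; exact: E.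
rewrite -fct_sumE.
elim/big_ind2 : _ => [|F a G b|i _].
- exact: is_derive_cst.
- exact: is_deriveD.
- by apply: derivableP; exact: diff_derivable.
Qed.

Lemma differentiable_bigsum n (P : pred 'I_n) (ell : 'I_n -> 'rV[R]_d -> R) x :
  (forall i, differentiable (ell i) x) ->
  differentiable (fun x => \sum_(i < n | P i) ell i x) x.
Proof.
move=> df; rewrite -fct_sumE.
elim/big_ind : _ => [|F G|i _] //.
exact: differentiableD.
Qed.

Lemma C2_sum n (P : pred 'I_n) (ell : 'I_n -> 'rV[R]_d -> R) :
  (forall i, C2 (ell i)) -> C2 (fun x => \sum_(i < n | P i) ell i x).
Proof.
move=> C2e; have df i y : differentiable (ell i) y by case: (C2e i).
have ddf j i y : differentiable (partial j (ell i)) y by case: (C2e i) => _ [].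
split; [|split].
- by move=> x; apply: differentiable_bigsum.
- by move=> j x; rewrite partial_sum //; apply: differentiable_bigsum.
- move=> i j; rewrite partial_sum // partial_sum //.
  apply: continuous_big => [|k _]; first exact: add_continuous.
  by case: (C2e k) => _ [_].
Qed.

End Analysis.

(** * Quadratic forms and dual norms *)

Section LinearAlgebra.
Set Implicit Arguments. Unset Strict Implicit.
Context {R : realType} {d : nat}.
Implicit Types (M A S H Sigma : 'M[R]_d) (u v w : 'rV[R]_d).

Lemma form_sym M u v : M^T = M -> (v *m M *m u^T) 0 0 = (u *m M *m v^T) 0 0.
Proof.
move=> sM; have -> : v *m M *m u^T = (u *m M *m v^T)^T.
  by rewrite !trmx_mul trmxK sM mulmxA.
by rewrite mxE.
Qed.

(** The form at [u + t *: v] is a polynomial of degree at most 2 in [t] that is nowhere negative; a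
    well-chosen [t] gives the bound. *)
Lemma psd_CauchySchwarz M u v : psd M ->
  ((u *m M *m v^T) 0 0) ^+ 2 <= (u *m M *m u^T) 0 0 * (v *m M *m v^T) 0 0.
Proof.
move=> [sM pM].
have quad t : 0 <= (u *m M *m u^T) 0 0 + 2 * t * (u *m M *m v^T) 0 0
    + t ^+ 2 * (v *m M *m v^T) 0 0.
  have := pM (u + t *: v).
  rewrite linearD linearZ /= !mulmxDl !mulmxDr -!scalemxAl -!scalemxAr.
  have := form_sym u v sM.
  move: (u *m M *m u^T) (u *m M *m v^T) (v *m M *m u^T) (v *m M *m v^T).
  move=> X Y Z W E h; apply: le_trans h _; rewrite !mxE E le_eqVlt.
  by apply/orP; left; apply/eqP; ring.
have := pM v; move: quad.
move: (_ 0 0) (_ 0 0) (_ 0 0) => c b a quad.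
rewrite le_eqVlt => /orP[/eqP c0|c0].
  have [->|b0] := eqVneq b 0; first by rewrite expr0n -c0 mulr0.
  (* Without quadratic term the polynomial is affine with slope [2 * b]; this [t] would give it the
     value -1. *)
  have := quad (- (a + 1) / (2 * b)).
  rewrite -c0 mulr0 addr0 (_ : a + _ = -1); first by rewrite oppr_ge0 ler10.
  by field.
(* The minimiser of the polynomial. *)
have := quad (- b / c).
rewrite (_ : _ + _ = (a * c - b ^+ 2) / c); last by field; rewrite gt_eqF.
by rewrite pmulr_lge0 ?invr_gt0 // subr_ge0.
Qed.

Lemma posdef_unitmx M : posdef M -> M \in unitmx.
Proof.
move=> [_ pM]; rewrite -row_free_unit -kermx_eq0; apply/rowV0P => v /sub_kermxP vM.
apply/eqP/negPn/negP => /pM; by rewrite vM mul0mx mxE ltxx.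
Qed.

Lemma posdef_psd M : posdef M -> psd M.
Proof.
move=> [sM pM]; split=> // v; have [->|/pM/ltW//] := eqVneq v 0.
by rewrite !mul0mx mxE.
Qed.

Lemma mnormE M v : mnorm M v^T = Num.sqrt ((v *m M *m v^T) 0 0).
Proof. by rewrite /mnorm trmxK. Qed.

Lemma sqr_mnorm M v : psd M -> mnorm M v^T ^+ 2 = (v *m M *m v^T) 0 0.
Proof. by move=> [_ pM]; rewrite mnormE sqr_sqrtr. Qed.

Lemma mnorm_ge0 M (v : 'cV[R]_d) : 0 <= mnorm M v.
Proof. exact: sqrtr_ge0. Qed.

Lemma mnormZ M v (t : R) : mnorm M (t *: v)^T = `|t| * mnorm M v^T.
Proof.
rewrite !mnormE linearZ /= -!scalemxAl -scalemxAr !mxE mulrA -expr2.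
by rewrite sqrtrM ?sqr_ge0 // sqrtr_sqr.
Qed.

(** Cauchy-Schwarz for the form [M] at [y^T *m invmx M] and [v]: [M] cancels in the mixed term, and
    the first square becomes the form of [invmx M] at [y]. *)
Lemma dual_CauchySchwarz M (y : 'cV[R]_d) v : posdef M ->
  `|(y^T *m v^T) 0 0| <= mnorm (invmx M) y * mnorm M v^T.
Proof.
move=> pdM; have uM := posdef_unitmx pdM; have pM := posdef_psd pdM.
have sI : (invmx M)^T = invmx M by rewrite trmx_inv pdM.1.
have := psd_CauchySchwarz (y^T *m invmx M) v pM.
rewrite mulmxKV // trmx_mul trmxK sI mulmxA => le2.
have y0 : 0 <= (y^T *m invmx M *m y) 0 0.
  by have := pM.2 (y^T *m invmx M); rewrite mulmxKV // trmx_mul trmxK sI mulmxA.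
by rewrite mnormE /mnorm -sqrtrM // -sqrtr_sqr ler_wsqrtr.
Qed.

(** Makes the Euclidean norm an instance of [mnorm], so that the estimates for forms apply to it. *)
Lemma posdef1 : posdef (1%:M : 'M[R]_d).
Proof.
split=> [|v v0]; first by rewrite trmx1.
have sq j : v 0 j * v^T j 0 = v 0 j ^+ 2 by rewrite mxE.
rewrite mulmx1 mxE (eq_bigr _ (fun j _ => sq j)).
have ge0 : forall j, true -> 0 <= v 0 j ^+ 2 by move=> j _; exact: sqr_ge0.
rewrite lt_def (sumr_ge0 _ ge0) andbT.
apply: contra_neq v0 => /(psumr_eq0P ge0) z; apply/rowP => j.
by rewrite mxE; apply/eqP; rewrite -sqrf_eq0 z.
Qed.

(** * Euclidean and operator norms *)

Lemma enormE (v : 'cV[R]_d) : enorm v = mnorm 1%:M v.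
Proof. by rewrite /enorm /mnorm mulmx1. Qed.

Lemma dot_enorm (x y : 'cV[R]_d) : `|(x^T *m y) 0 0| <= enorm x * enorm y.
Proof.
have := dual_CauchySchwarz x y^T posdef1.
by rewrite invmx1 !trmxK -!enormE.
Qed.

Lemma sqr_enorm (v : 'cV[R]_d) : enorm v ^+ 2 = (v^T *m v) 0 0.
Proof.
rewrite enormE -[v in LHS]trmxK sqr_mnorm; last exact/posdef_psd/posdef1.
by rewrite mulmx1 trmxK.
Qed.

Lemma enorm_gt0 (v : 'cV[R]_d) : v != 0 -> 0 < enorm v.
Proof.
move=> v0; rewrite /enorm sqrtr_gt0.
have : v^T != 0 by rewrite trmx_eq0.
by move=> /posdef1.2; rewrite mulmx1 trmxK.
Qed.

(** Cauchy-Schwarz on each row bounds the quotients by the Frobenius norm; [sup] in [opnorm] is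
    thereby a genuine upper bound. *)
Lemma opnorm_has_ubound A :
  has_ubound [set enorm (A *m v) / enorm v | v in [set v : 'cV[R]_d | v != 0]].
Proof.
exists (Num.sqrt (\sum_i enorm (row i A)^T ^+ 2)) => _ [v /= v0 <-].
have N (x : 'cV[R]_d) : 0 <= enorm x by exact: sqrtr_ge0.
rewrite ler_pdivrMr ?enorm_gt0 //.
rewrite -(ler_pXn2r (n := 2)) ?nnegrE ?mulr_ge0 ?sqrtr_ge0 //.
rewrite exprMn sqr_enorm mxE sqr_sqrtr; last first.
  by apply: sumr_ge0 => i _; exact: sqr_ge0.
rewrite mulr_suml; apply: ler_sum => i _.
have := dot_enorm (row i A)^T v; rewrite trmxK -row_mul.
have -> : (A *m v)^T 0 i = (A *m v) i 0 by rewrite mxE.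
have -> : row i (A *m v) 0 0 = (A *m v) i 0 by rewrite mxE.
by rewrite -expr2 -exprMn -real_normK ?num_real // ler_pXn2r ?nnegrE ?mulr_ge0.
Qed.

Lemma enorm_le_opnorm A (v : 'cV[R]_d) : enorm (A *m v) <= opnorm A * enorm v.
Proof.
have [->|v0] := eqVneq v 0.
  by rewrite mulmx0 /enorm mulmx0 mxE sqrtr0 mulr0.
rewrite -ler_pdivrMr ?enorm_gt0 //.
by apply: ub_le_sup; [exact: opnorm_has_ubound|exists v].
Qed.

Lemma opnorm_ge0 A : 0 <= opnorm A.
Proof.
(* In dimension 0 there is no nonzero vector, and the supremum of the empty set is 0 by
   convention. *)
have [E|/set0P[_ [v v0 _]]] :=
    eqVneq [set enorm (A *m v) / enorm v | v in [set v : 'cV[R]_d | v != 0]] set0.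
  by rewrite /opnorm E sup0.
apply: (@le_trans _ _ (enorm (A *m v) / enorm v)).
  by rewrite divr_ge0 ?sqrtr_ge0.
by apply: ub_le_sup; [exact: opnorm_has_ubound|exists v].
Qed.

(* Cauchy-Schwarz for the form [H], applied to [v] and [H^-1 Sigma v]. *)
Lemma opnorm_coercive H S v (C : R) : psd H -> H \in unitmx -> S^T = S ->
  opnorm (S *m invmx H *m S) <= C -> 0 < (v *m (S *m S) *m v^T) 0 0 ->
  (v *m (S *m S) *m v^T) 0 0 <= C * (v *m H *m v^T) 0 0.
Proof.
move=> pH uH sS opC.
have sI : (invmx H)^T = invmx H by rewrite trmx_inv pH.1.
set y := v *m (S *m S) *m invmx H.
set w := (v *m S)^T.
have Ew : enorm w ^+ 2 = (v *m (S *m S) *m v^T) 0 0.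
  by rewrite sqr_enorm /w trmxK trmx_mul sS !mulmxA.
have yHv : y *m H *m v^T = v *m (S *m S) *m v^T by rewrite /y mulmxKV.
have yHy : y *m H *m y^T = w^T *m (S *m invmx H *m S *m w).
  by rewrite /y mulmxKV // /w trmxK !trmx_mul sI sS !mulmxA.
have := psd_CauchySchwarz y v pH.
rewrite yHv yHy.
(* The form of [H] at [y] is the matrix inside [opnorm] evaluated at [w], so it is at most
   [C * enorm w ^+ 2]. *)
have : (w^T *m (S *m invmx H *m S *m w)) 0 0 <= C * enorm w ^+ 2.
  apply: le_trans (ler_norm _) _; apply: le_trans (dot_enorm _ _) _.
  rewrite expr2 mulrCA; apply: ler_wpM2l; first exact: sqrtr_ge0.
  apply: le_trans (enorm_le_opnorm _ _) _.
  by apply: ler_wpM2r => //; exact: sqrtr_ge0.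
rewrite Ew; have := pH.2 v.
move: (_ 0 0) (_ 0 0) (_ 0 0) => p q a q0 h1 h2 a0.
(* From [a ^+ 2 <= p * q] and [p <= C * a], one factor [a > 0] cancels. *)
rewrite -(ler_pM2l a0) -expr2 (le_trans h2) // (le_trans (ler_wpM2r q0 h1)) //.
by rewrite [leRHS]mulrCA mulrA.
Qed.

(** Expanding [K - H] leaves [K] applied to the Newton step, minus [g]. For [K] the Hessian at the
    mean value point, this links the vector of the Lipschitz hypothesis to the gradient at the
    Newton estimate. *)
Lemma newton_residual (g : 'cV[R]_d) H K : H^T = H -> K^T = K -> H \in unitmx ->
  ((K - H) *m invmx H *m g)^T = (invmx H *m g)^T *m K - g^T.
Proof.
move=> sH sK uH; rewrite -mulmxA trmx_mul linearB /= sK sH mulmxBr.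
by congr (_ - _); rewrite -[LHS]trmxK trmx_mul trmxK sH mulKVmx.
Qed.

End LinearAlgebra.

(** * Distance from the Newton step to the retrained model *)

Theorem mainTheorem1 (R : realType) (d n : nat)
  (ell : 'I_n -> 'rV[R]_d -> R) (T : {set 'I_n})
  (theta_hat theta_T : 'rV[R]_d)
  (Sigma Sigma_half : 'M[R]_d) (r C_op C_h : R) :
  (forall i, C2 (ell i)) ->
  let L_T := fun theta => \sum_(i < n | i \notin T) ell i theta in
  convex_on_Rd L_T ->
  \sum_(i < n) grad (ell i) theta_hat = 0 ->
  grad L_T theta_T = 0 ->
  let g := (grad L_T theta_hat)^T in
  let H := hess L_T theta_hat in
  H \in unitmx ->
  let theta_NS := theta_hat - (invmx H *m g)^T in
  posdef Sigma ->
  psd Sigma_half -> Sigma_half *m Sigma_half = Sigma ->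
  0 < r ->
  let B := [set theta : 'rV[R]_d | mnorm Sigma (theta - theta_NS)^T <= r] in
  (forall theta, B theta ->
     hess L_T theta \in unitmx /\
     opnorm (Sigma_half *m invmx (hess L_T theta) *m Sigma_half) <= C_op) ->
  (forall t : R, 0 <= t -> t <= 1 ->
     let theta := t *: theta_hat + (1 - t) *: theta_NS in
     mnorm (invmx Sigma) ((hess L_T theta - H) *m invmx H *m g) <= C_h) ->
  C_h * C_op < r ->
  mnorm Sigma (theta_T - theta_NS)^T <= C_h * C_op.
Proof.
move=> C2ell L_T cvxL _ gradT g H uH theta_NS pdS psdSh SSh r0 B HB Hh Clt.
have C2L : C2 L_T by exact: (C2_sum (fun i => i \notin T) C2ell).
have psdH x : psd (hess L_T x) by exact: convex_hess_psd.
have psdS := posdef_psd pdS.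
set e := theta_T - theta_NS.
pose m := mnorm Sigma e^T.
(* Both constants dominate a norm: [C_h] at [t = 0], and [C_op] at the centre of the ball. *)
have Ch0 : 0 <= C_h by exact: le_trans (mnorm_ge0 _ _) (Hh 0 (lexx _) ler01).
have Cop0 : 0 <= C_op.
  have [|_] := HB theta_NS; last exact/le_trans/opnorm_ge0.
  by rewrite /B /= subrr trmx0 /mnorm mulmx0 mxE sqrtr0 ltW.
rewrite -/m; have [e0|e0] := eqVneq e 0.
  by rewrite /m e0 trmx0 /mnorm mulmx0 mxE sqrtr0 mulr_ge0.
have a0 : 0 < (e *m Sigma *m e^T) 0 0 by exact: pdS.2.
have m2 : m ^+ 2 = (e *m Sigma *m e^T) 0 0 by exact: sqr_mnorm.
have m0 : 0 < m by rewrite /m mnormE sqrtr_gt0.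
have grad_NS : - (C_h * m) <= (grad L_T theta_NS *m e^T) 0 0.
  (* The segment from [theta_NS] to [theta_hat] has direction [p]; its mean value point has weight
     [c] on [theta_hat], which is the parameter [t] of the Lipschitz hypothesis. *)
  pose p := (invmx H *m g)^T.
  have [c /andP[/ltW c0 /ltW c1]] := grad_line_MVT theta_NS p e C2L ltr01.
  rewrite scale1r scale0r addr0 subr0 mul1r.
  have Ep : theta_NS + p = theta_hat by rewrite /theta_NS subrK.
  have -> : theta_NS + c *: p = c *: theta_hat + (1 - c) *: theta_NS.
    rewrite -Ep; move: (theta_NS) => q.
    by rewrite scalerDr scalerBl scale1r [RHS]addrAC [X in _ = X + _]addrC subrK.
  rewrite Ep.
  set x := c *: theta_hat + _ => E.
  have := Hh c c0 c1; rewrite /= -/x; set y := _ *m g => yC.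
  have yE : y^T = p *m hess L_T x - grad L_T theta_hat.
    by rewrite (newton_residual _ (psdH _).1 (psdH _).1 uH) trmxK.
  (* The mean value identity and the residual formula both contain [p *m hess L_T x]; eliminating it
     leaves only the residual [y], paired with [e]. *)
  have -> : (grad L_T theta_NS *m e^T) 0 0 = - (y^T *m e^T) 0 0.
    rewrite yE mulmxBl; move: E.
    move: (grad _ _ *m _) (grad _ _ *m _) (p *m _ *m _) => X Y Z E.
    by rewrite !mxE -E; ring.
  rewrite lerN2; apply: le_trans (ler_norm _) _.
  apply: le_trans (dual_CauchySchwarz _ _ pdS) _.
  by apply: ler_wpM2r => //; exact: ltW.
(* The largest [s <= 1] for which [theta_NS + s *: e] is still in the ball. *)
pose s := Num.min 1 (r / m).
have s0 : 0 < s by rewrite lt_min ltr01 divr_gt0.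
have s1 : s <= 1 by rewrite ge_min lexx.
have smr : s * m <= r by rewrite -ler_pdivlMr // ge_min lexx orbT.
have [c /andP[c0 cs]] := grad_line_MVT theta_NS e e C2L s0.
rewrite scale0r addr0 subr0.
(* Since [0 < c < s], the mean value point is in the ball, where the Hessian is coercive. *)
have [|uHc opHc] := HB (theta_NS + c *: e).
  rewrite /B /= addrAC subrr add0r mnormZ gtr0_norm //.
  by apply: le_trans smr; apply: ler_wpM2r; exact: ltW.
have := opnorm_coercive (v := e) (psdH _) uHc psdSh.1 opHc.
rewrite SSh -m2 exprn_gt0 // => /(_ isT).
move: (e *m hess _ _ *m _) => Q coer E.
(* The rest of the segment, up to [theta_T], may leave the ball; there only the positive
   semidefiniteness given by convexity is used. *)
have mono : (grad L_T (theta_NS + s *: e) *m e^T) 0 0 <= 0.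
  have -> : 0 = (grad L_T (theta_NS + 1 *: e) *m e^T) 0 0.
    by rewrite scale1r /e addrC subrK gradT mul0mx mxE.
  have [->//|sn1] := eqVneq s 1.
  have lt_s1 : s < 1 by rewrite lt_neqAle sn1.
  have [t _ D] := grad_line_MVT theta_NS e e C2L lt_s1.
  by rewrite -subr_ge0 D mulr_ge0 ?(psdH _).2 // subr_ge0.
have sQ : s * Q 0 0 <= C_h * m.
  move: grad_NS mono; rewrite -E.
  move: (grad _ _ *m _) (grad _ _ *m _) => X Y; clear; lra.
(* Coercivity gives [s * m ^+ 2 <= C_op * (s * Q 0 0) <= C_op * C_h * m], and one factor [m > 0]
   cancels. *)
have sm : s * m <= C_h * C_op.
  rewrite -(ler_pM2r m0) -mulrA -expr2.
  apply: (@le_trans _ _ (C_op * (s * Q 0 0))).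
    by rewrite [leRHS]mulrCA; apply: ler_wpM2l => //; exact: ltW.
  by rewrite (mulrC C_h) -mulrA; apply: ler_wpM2l.
(* If [theta_T] were outside the ball, then [s * m = r], against [C_h * C_op < r]. *)
have [rm|mr] := ltP (r / m) 1.
  have sE : s = r / m by apply/min_idPr/ltW.
  by have := le_lt_trans sm Clt; rewrite sE divfK ?gt_eqF // ltxx.
have sE : s = 1 by apply/min_idPl.
by move: sm; rewrite sE mul1r.
Qed.
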